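(* Let $G=G_{p_1}\oplus\cdots\oplus G_{p_m}$ be a finite abelian group, with $p_1,\dots,p_m$ distinct primes and each $G_{p_j}=\mathbb{Z}_{p_j^{r_{j,1}}}^{k_{j,1}}\oplus\cdots\oplus\mathbb{Z}_{p_j^{r_{j,s_j}}}^{k_{j,s_j}}$ with $1\le r_{j,1}<\cdots<r_{j,s_j}$ and all $k_{j,i}\ge1$. Then the number of orbits of $\mathrm{Aut}(G)$ acting on the elements of $G$ equals the product over $j=1,\dots,m$ of the number of orbits of $\mathrm{Aut}(G_{p_j}^{rf})$ on $G_{p_j}^{rf}=\mathbb{Z}_{p_j^{r_{j,1}}}\oplus\cdots\oplus\mathbb{Z}_{p_j^{r_{j,s_j}}}$; that is, it equals $$\prod_{j=1}^m (r_{j,1}+1)\prod_{i=1}^{s_j-1}\bigl(r_{j,i+1}-r_{j,i}+1\bigr).$$ *)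

(* Defs.v *)
From HB Require Import structures.
From mathcomp Require Import all_boot all_order all_algebra all_fingroup all_solvable.
Set Implicit Arguments. Unset Strict Implicit. Unset Printing Implicit Defensive.

Local Open Scope group_scope.

Definition aut_orbit_count (gT : finGroupType) (G : {group gT}) : nat :=
  #|orbit 'P (Aut G) @: G|.

(* G is (internally) the direct sum of cyclic subgroups whose orders are,
   as a multiset, the sequence [q]; i.e. G is isomorphic to
   Z_{q_1} (+) ... (+) Z_{q_n}. *)
Definition cyclic_decomp_type (gT : finGroupType) (G : {group gT})
    (q : seq nat) : Prop :=
  exists b : seq gT,
    \big[dprod/1]_(x <- b) <[x]> = G /\ perm_eq [seq #[x] | x <- b] q.

Local Open Scope nat_scope.

Definition primary_type (p s : nat) (r k : nat -> nat) : seq nat :=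
  flatten [seq nseq (k i) (p ^ r i) | i <- iota 0 s].

Definition full_type (m : nat) (p s : nat -> nat) (r k : nat -> nat -> nat)
  : seq nat :=
  flatten [seq primary_type (p j) (s j) (r j) (k j) | j <- iota 0 m].

Definition rf_type (p s : nat) (r : nat -> nat) : seq nat :=
  [seq p ^ r i | i <- iota 0 s].

Definition orbit_factor (s : nat) (r : nat -> nat) : nat :=
  (r 0).+1 * \prod_(i < s.-1) (r i.+1 - r i).+1.

(* Main.v *)
(* Write G as a direct sum of cyclic groups C_i of orders p_i ^ R_i, and
   attach to x in G the p_i-adic valuations h_i of its coordinates, capped at R_i.
   Adding to the i-th coordinate the image of the j-th one under a homomorphism
   C_j -> C_i is an automorphism; repeating this until the sum of the h_i is
   minimal, every orbit contains an element with h_i <= h_j + max(0, R_i - R_j)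
   whenever p_i = p_j. An automorphism cannot lower the heights of such an
   element, so these heights are determined by the orbit; conversely they
   determine it, because elements with equal heights differ by units in each
   coordinate. Closed height vectors depend only on the distinct pairs (p, R), and
   for each prime they are the sequences h with 0 <= h_1 <= r_1 and
   0 <= h_(i+1) - h_i <= r_(i+1) - r_i: the jumps are independent, which yields
   the product. *)
Require Import Defs.
From HB Require Import structures.
From mathcomp Require Import all_boot all_order all_algebra all_fingroup all_solvable.
From mathcomp Require Import zify.

Set Implicit Arguments. Unset Strict Implicit. Unset Printing Implicit Defensive.

Local Open Scope group_scope.
Local Open Scope nat_scope.

(** * Congruences and capped valuations *)

Lemma eqn_modM_dvd (d e a c c' : nat) :
  e %| d * a -> c = c' %[mod d] -> c * a = c' * a %[mod e].
Proof.
move=> e_da eq_c; rewrite -(modn_dvdm (c * a) e_da) -(modn_dvdm (c' * a) e_da).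
by rewrite -!muln_modl eq_c.
Qed.

Lemma eqn_mod_sum (I : finType) (d : nat) (F F' : I -> nat) :
  (forall i, F i = F' i %[mod d]) -> \sum_i F i = \sum_i F' i %[mod d].
Proof. by move=> eqF; rewrite -modn_summ (eq_bigr _ (fun i _ => eqF i)) modn_summ. Qed.

(* Capped at [r], so that the height is [r], not [0], when [p ^ r] divides [c]
   (in particular when [c = 0]). *)
Definition height (p r c : nat) : nat := logn p (gcdn c (p ^ r)).

Lemma leq_height p r c e :
  prime p -> (e <= height p r c) = (e <= r) && (p ^ e %| c).
Proof.
move=> pr_p; rewrite /height -pfactor_dvdn //; last by rewrite gcdn_gt0 expn_gt0 (prime_gt0 pr_p) orbT.
by rewrite dvdn_gcd dvdn_Pexp2l ?prime_gt1 // andbC.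
Qed.

Lemma height_leq p r c : prime p -> height p r c <= r.
Proof. by move=> pr_p; have := leqnn (height p r c); rewrite leq_height // => /andP[]. Qed.

Lemma dvdn_height p r c : prime p -> p ^ height p r c %| c.
Proof. by move=> pr_p; have := leqnn (height p r c); rewrite leq_height // => /andP[]. Qed.

Lemma height_mod p r c c' : c = c' %[mod p ^ r] -> height p r c = height p r c'.
Proof. by rewrite /height -gcdn_modl => ->; rewrite gcdn_modl. Qed.

Lemma height_exp p r e : prime p -> e <= r -> height p r (p ^ e) = e.
Proof.
move=> pr_p le_er; apply/eqP; rewrite eqn_leq leq_height // le_er dvdnn /= andbT.
by have := dvdn_height r (p ^ e) pr_p; rewrite dvdn_Pexp2l ?prime_gt1.
Qed.

(** At the cap, [c] vanishes modulo [p ^ r] and any unit will do, here 1. Below it, a cofactor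
    divisible by [p] would raise the height. *)
Lemma height_unit p r c : prime p ->
  exists2 u, coprime p u & p ^ height p r c * u = c %[mod p ^ r].
Proof.
move=> pr_p; have := height_leq r c pr_p; rewrite leq_eqVlt => /predU1P[eq_r | lt_r].
  exists 1; rewrite ?coprimen1 // muln1.
  have := dvdn_height r c pr_p; rewrite eq_r => /eqP->.
  by rewrite modnn.
have /dvdnP[u cE] := dvdn_height r c pr_p; exists u; last by rewrite mulnC -cE.
rewrite prime_coprime //; apply/negP => p_u.
have := ltnn (height p r c); rewrite leq_height // lt_r.
by rewrite [X in _ %| X]cE expnS dvdn_mul.
Qed.

Lemma pfactor_dvdn_mul p m n a : prime p -> p ^ m %| p ^ n * a -> p ^ (m - n) %| a.
Proof.
move=> pr_p; have [le_mn | /ltnW le_nm] := leqP m n.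
  by rewrite (eqP le_mn) expn0 dvd1n.
by rewrite -{1}(subnKC le_nm) expnD dvdn_pmul2l // expn_gt0 prime_gt0.
Qed.

(** * Coordinates and matrices of automorphisms *)

Section CyclicDecomposition.

Variables (gT : finGroupType) (G : {group gT}) (I : finType) (b : I -> gT).
Hypothesis defG : (\big[dprod/1]_i <[b i]>)%g = G.

Definition coord_prod (c : I -> nat) : gT := (\prod_i b i ^+ c i)%g.

(** Row vector times matrix over the naturals; row [l] holds coordinates of the image of [b l]. *)
Definition row_mulmx (c : I -> nat) (A : I -> I -> nat) (i : I) : nat :=
  \sum_l c l * A l i.

Lemma bigdprod_abelian : abelian G.
Proof.
move: (G) defG; elim/big_rec: _ => [H <- | i B _ IH H]; first exact: abelian1.
case/dprodP=> [[K L _ defL] <- cKL _]; rewrite defL in IH cKL *.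
by rewrite abelianM cycle_abelian (IH L) //= centsC.
Qed.

Lemma mem_basis i : b i \in G.
Proof.
rewrite -cycle_subG -(bigdprodWY defG) (bigD1 i) //=; apply: sub_gen.
exact: subsetUl.
Qed.

Lemma coord_prod_in c : coord_prod c \in G.
Proof. by apply: group_prod => i _; rewrite groupX ?mem_basis. Qed.

Lemma coord_prod_surj x : x \in G -> exists c, x = coord_prod c.
Proof.
move/(mem_bigdprod defG)=> [e [e_b -> _]].
have /fin_all_exists[c ec] i : exists n, e i = (b i ^+ n)%g.
  by apply/cycleP; apply: e_b.
by exists c; apply: eq_bigr => i _.
Qed.

Lemma coord_prodP c c' :
  coord_prod c = coord_prod c' <-> forall i, c i = c' i %[mod #[b i]].
Proof.
split=> [eq_cc' i | eq_cc']; last first.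
  by apply: eq_bigr => i _; apply/eqP; rewrite eq_expg_mod_order eq_cc'.
apply/eqP; rewrite -eq_expg_mod_order; apply/eqP.
have [e [_ _ e_uniq]] := mem_bigdprod defG (coord_prod_in c).
by rewrite (e_uniq (fun i => b i ^+ c i)%g) ?(e_uniq (fun i => b i ^+ c' i)%g) //
   => j _; apply: mem_cycle.
Qed.

Lemma coord_prodD c c' :
  (coord_prod c * coord_prod c')%g = coord_prod (fun i => c i + c' i).
Proof.
have cG := centsP bigdprod_abelian.
(* Membership is carried through the induction because commutation is available only inside [G]. *)
rewrite /coord_prod; pose in3 x y z := [/\ x \in G, y \in G & (x * y)%g = z].
suffices [] : in3 (\prod_i b i ^+ c i)%g (\prod_i b i ^+ c' i)%g
              (\prod_i b i ^+ (c i + c' i))%g by [].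
elim/big_rec3: _ => [|i z y x _ [Gx Gy <-]]; first by split; rewrite ?mulg1.
split; rewrite ?groupM ?groupX ?mem_basis //.
rewrite expgD !mulgA; congr (_ * _)%g; rewrite -!mulgA; congr (_ * _)%g.
by apply: cG; rewrite ?groupX ?mem_basis.
Qed.

Lemma coord_prod0 : coord_prod (fun=> 0) = 1%g.
Proof. by apply: big1. Qed.

Lemma coord_prodX c n : (coord_prod c ^+ n)%g = coord_prod (fun i => n * c i).
Proof.
elim: n => [|n IHn]; first by rewrite expg0 -coord_prod0.
by rewrite expgS IHn coord_prodD.
Qed.

Lemma coord_prod_mulmx c A :
  (\prod_l coord_prod (A l) ^+ c l)%g = coord_prod (row_mulmx c A).
Proof.
rewrite (eq_bigr _ (fun l _ => coord_prodX (A l) (c l))) /row_mulmx.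
elim: (index_enum I) => [|l s IHs].
  rewrite big_nil -coord_prod0.
  by apply: eq_bigr => i _; rewrite big_nil.
rewrite big_cons IHs coord_prodD.
by apply: eq_bigr => i _; rewrite big_cons.
Qed.

Lemma row_mulmx_eqmod A c c' :
    (forall l i, #[b i] %| #[b l] * A l i) ->
    (forall l, c l = c' l %[mod #[b l]]) ->
  forall i, row_mulmx c A i = row_mulmx c' A i %[mod #[b i]].
Proof. by move=> homA eq_c i; apply: eqn_mod_sum => l; apply: eqn_modM_dvd. Qed.

(** The first hypothesis makes the map independent of the chosen coordinates, the second makes its
    kernel trivial; finiteness then gives surjectivity. *)
Lemma mulmx_Aut A :
    (forall l i, #[b i] %| #[b l] * A l i) ->
    (forall c, (forall i, #[b i] %| row_mulmx c A i) ->
       forall i, #[b i] %| c i) ->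
  exists2 a, a \in Aut G
    & forall c, a (coord_prod c) = coord_prod (row_mulmx c A).
Proof.
move=> homA injA.
have /fin_all_exists[crd crdE] (x : gT) :
    exists c : I -> nat, x \in G -> x = coord_prod c.
  case: (boolP (x \in G)) => [/coord_prod_surj[c ->]|_]; first by exists c.
  by exists (fun=> 0).
pose f x := coord_prod (row_mulmx (crd x) A).
have fE c : f (coord_prod c) = coord_prod (row_mulmx c A).
  apply/coord_prodP; apply: row_mulmx_eqmod => //.
  by apply/coord_prodP; rewrite -crdE ?coord_prod_in.
have fM : {in G &, {morph f : x y / (x * y)%g}}.
  move=> _ _ /coord_prod_surj[c ->] /coord_prod_surj[c' ->].
  rewrite coord_prodD !fE coord_prodD; apply: eq_bigr => i _; congr (_ ^+ _)%g.
  by rewrite /row_mulmx -big_split; apply: eq_bigr => l _; rewrite mulnDl.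
pose phi := Morphism fM.
have injf : 'injm phi.
  apply/subsetP => x /morphpreP[/coord_prod_surj[c ->] /set1P].
  rewrite /phi /= fE -coord_prod0 => /coord_prodP c0; apply/set1P.
  rewrite -coord_prod0; apply/coord_prodP => i.
  by apply/eqP; rewrite mod0n; apply: injA => l; rewrite /dvdn c0 mod0n.
have fG : phi @* G = G.
  apply/(morphim_fixP injf); rewrite ?subxx //; apply/subsetP => _ /morphimP[x _ _ ->].
  exact: coord_prod_in.
exists (aut injf fG); first exact: Aut_aut.
by move=> c; rewrite autE ?coord_prod_in.
Qed.

(** The divisibility expresses that the image of [b l] is killed by [#[b l]]. *)
Lemma Aut_mulmx a : a \in Aut G ->
  exists2 A, forall l i, #[b i] %| #[b l] * A l i
    & forall c, a (coord_prod c) = coord_prod (row_mulmx c A).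
Proof.
move=> aG; rewrite -(autmE aG).
have /fin_all_exists[A aE] l : exists c, autm aG (b l) = coord_prod c.
  by apply: coord_prod_surj; apply: Aut_closed => //; apply: mem_basis.
exists A => [l | c].
  have: coord_prod (fun i => #[b l] * A l i) = coord_prod (fun=> 0).
    rewrite coord_prod0 -coord_prodX -aE -morphX ?mem_basis //.
    by rewrite expg_order morph1.
  by move/coord_prodP => eq0 i; rewrite /dvdn eq0 mod0n.
rewrite -coord_prod_mulmx morph_prod => [|i _]; last by rewrite groupX ?mem_basis.
by apply: eq_bigr => l _; rewrite morphX ?mem_basis //= -aE.
Qed.

(** * Heights along automorphism orbits *)

Variables P R : I -> nat.
Hypothesis prP : forall i, prime (P i).
Hypothesis order_b : forall i, #[b i] = P i ^ R i.

Definition heights (c : I -> nat) (i : I) : nat := height (P i) (R i) (c i).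

(* A homomorphism from a cyclic group of order [p ^ R j] to one of order
   [p ^ R i] raises heights by at least [R i - R j] (truncated), and one of them
   raises them by exactly that; [h] is closed if no transvection built from such
   a homomorphism can lower one of its entries. *)
Definition closed_heights (h : I -> nat) : Prop :=
  forall i j, P i = P j -> h i <= h j + (R i - R j).

(** Each summand [c l * A l i] is divisible by [P i ^ heights c i]. For equal primes, [A l i]
    contributes [R i - R l] factors and closedness bounds the rest. *)
Lemma heights_le_Aut c c' a :
    a \in Aut G -> a (coord_prod c) = coord_prod c' ->
    closed_heights (heights c) ->
  forall i, heights c i <= heights c' i.
Proof.
move=> /Aut_mulmx[A homA aE]; rewrite aE => /coord_prodP eq_c' hc i.
rewrite {2}/heights (@height_mod _ _ _ (row_mulmx c A i)) -?order_b //.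
rewrite leq_height // height_leq //=; apply: dvdn_sum => l _.
have := homA l i; rewrite !order_b; have [eqPij dvA | neqPij] := eqVneq (P i) (P l).
  have dv_cl : P l ^ heights c l %| c l by apply: dvdn_height.
  rewrite -eqPij in dvA; rewrite -eqPij in dv_cl.
  apply: dvdn_trans (dvdn_mul dv_cl (pfactor_dvdn_mul (prP i) dvA)).
  by rewrite -expnD dvdn_exp2l // hc.
(* For distinct primes the whole power [P i ^ R i] must divide [A l i]. *)
rewrite Gauss_dvdr; last first.
  by rewrite coprimeXl // coprimeXr // prime_coprime // dvdn_prime2.
by move/(dvdn_trans (dvdn_exp2l (P i) (height_leq (R i) (c i) (prP i))))/dvdn_mull.
Qed.

(** The diagonal matrix of the units given by [height_unit] is an automorphism. *)
Lemma orbit_heights c :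
  coord_prod c \in orbit 'P (Aut G) (coord_prod (fun i => P i ^ heights c i)).
Proof.
have /fin_all_exists2[u coP_u cE] i : exists2 u, coprime (P i) u
    & P i ^ heights c i * u = c i %[mod #[b i]].
  by rewrite order_b; apply: height_unit.
pose A l i := (l == i) * u i.
have AE c' i : row_mulmx c' A i = c' i * u i.
  rewrite /row_mulmx (bigD1 i) //= /A eqxx mul1n big1 ?addn0 // => l /negPf->.
  by rewrite muln0.
have [l i | c' dv i | a aG aE] := @mulmx_Aut A.
- rewrite /A; have [-> | _] := eqVneq l i; last by rewrite muln0.
  by rewrite dvdn_mulr.
- by have := dv i; rewrite AE Gauss_dvdl // order_b coprimeXl.
apply/orbitP; exists a => //; rewrite /= apermE aE.
by apply/coord_prodP => i; rewrite AE.
Qed.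

(** Truncated subtraction gives the least power of [P i] by which [b j] can be sent into [<[b i]>].
    In the kernel all coordinates but the [i]-th vanish at once, and [dv_t] then removes the term
    added to that one. *)
Lemma transvection_Aut i j : i != j -> P i = P j ->
  exists2 a, a \in Aut G & forall c, a (coord_prod c) =
    coord_prod (fun l => c l + (l == i) * (c j * P i ^ (R i - R j))).
Proof.
move=> ne_ij eqPij; set t := P i ^ _.
pose A l k := (l == k) + (l == j) * ((k == i) * t).
have AE c k : row_mulmx c A k = c k + (k == i) * (c j * t).
  rewrite /row_mulmx /A; under eq_bigr do rewrite mulnDr.
  rewrite big_split /= (bigD1 k) //= eqxx muln1 big1 ?addn0 => [|l /negPf->]; last first.
    by rewrite muln0.
  rewrite (bigD1 j) //= eqxx mul1n big1 ?addn0 => [|l /negPf->]; last first.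
    by rewrite mul0n muln0.
  by rewrite mulnCA.
have dv_t : #[b i] %| #[b j] * t.
  by rewrite !order_b -eqPij -expnD dvdn_exp2l // -maxnE leq_maxr.
have [l k | c dv k | a aG aE] := @mulmx_Aut A; last first.
- by exists a => // c; rewrite aE; apply: eq_bigr => k _; rewrite AE.
- have dv_ne l : l != i -> #[b l] %| c l.
    by move=> /negPf ne_li; have := dv l; rewrite AE ne_li addn0.
  have [-> | /dv_ne //] := eqVneq k i.
  have := dv i; rewrite AE eqxx mul1n dvdn_addl //.
  apply: dvdn_trans dv_t _; apply: dvdn_mul => //.
  by apply: dv_ne; rewrite eq_sym.
rewrite /A mulnDr dvdn_add //.
  by have [-> | _] := eqVneq l k; [apply: dvdn_mulr | rewrite muln0].
have [-> | _] := eqVneq l j; last by rewrite mul0n muln0.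
by have [-> | _] := eqVneq k i; rewrite ?mul1n // muln0.
Qed.

Lemma orbit_closed c : exists2 c',
  coord_prod c' \in orbit 'P (Aut G) (coord_prod c) & closed_heights (heights c').
Proof.
have [n] := ubnP (\sum_i heights c i); elim: n c => // n IHn c le_n.
have [/forallP hc | ] := boolP [forall i, [forall j,
    (P i == P j) ==> (heights c i <= heights c j + (R i - R j))]].
  exists c; first exact: orbit_refl.
  by move=> i j eqPij; have /forallP/(_ j) := hc i; rewrite eqPij eqxx.
rewrite negb_forall => /existsP[i]; rewrite negb_forall => /existsP[j].
rewrite negb_imply -ltnNge => /andP[/eqP eqPij lt_ji].
have ne_ij : i != j.
  by apply: contraL lt_ji => /eqP->; rewrite -leqNgt leq_addr.
have [a aG aE] := transvection_Aut ne_ij eqPij.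
pose c1 l := c l + (l == i) * (c j * P i ^ (R i - R j)).
have c1_ne l : l != i -> heights c1 l = heights c l.
  by rewrite /heights /c1 => /negPf->; rewrite addn0.
(* Otherwise [P i ^ heights c i] would divide the added term, forcing the height of [c j] up to
   [heights c i - (R i - R j)], against [lt_ji]. *)
have c1_lt : heights c1 i < heights c i.
  rewrite ltnNge leq_height // height_leq //= /c1 eqxx mul1n.
  rewrite dvdn_addr ?dvdn_height //; apply/negP => dv.
  move: lt_ji; rewrite ltnNge => /negP[]; rewrite addnC -leq_subLR.
  rewrite {2}/heights leq_height // -eqPij; apply/andP; split.
    rewrite leq_subLR (leq_trans (height_leq _ _ (prP i))) //.
    by rewrite addnC -leq_subLR.
  by apply: pfactor_dvdn_mul => //; rewrite mulnC.
have [|c' orb_c' hc'] := IHn c1.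
  rewrite -ltnS; apply: leq_trans le_n; rewrite ltnS.
  rewrite (bigD1 i) // [in X in _ < X](bigD1 i) //=.
  by rewrite (eq_bigr _ c1_ne) ltn_add2r.
exists c' => //; apply: orbit_trans orb_c' _.
by apply/orbitP; exists a; rewrite //= apermE aE.
Qed.

End CyclicDecomposition.

(** * Sequences with bounded jumps *)

Definition gap (f : nat -> nat) (i : nat) : nat := if i is l.+1 then f i - f l else f 0.

Lemma sum_gap f n :
  (forall i, i < n -> f i <= f i.+1) -> \sum_(l < n.+1) gap f l = f n.
Proof.
elim: n => [_|n IHn homo_f]; first by rewrite big_ord1.
rewrite big_ord_recr /= IHn => [|i lt_in]; first by rewrite subnKC ?homo_f.
by rewrite homo_f // ltnW.
Qed.

(** The convention that the jump at 0 is [r 0] absorbs the separate first factor. *)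
Lemma orbit_factor_gap s r : 0 < s ->
  orbit_factor s r = \prod_(i < s.-1.+1) (gap r i).+1.
Proof. by rewrite big_ord_recl. Qed.

(** Constraints on neighbours suffice: [f] is monotone, and the bounds on its increments
    telescope. *)
Lemma leq_gaps (f r : nat -> nat) n :
    (forall i, i < n -> r i <= r i.+1) ->
    (forall i, i < n -> f i <= f i.+1 <= f i + (r i.+1 - r i)) ->
  forall i j, i <= n -> j <= n -> f i <= f j + (r i - r j).
Proof.
move=> homo_r gap_f i j le_in le_jn.
have [le_ij | /ltnW le_ji] := leqP i j.
  apply: leq_trans (leq_addr _ _).
  elim: j le_ij le_jn => [|j IHj]; first by rewrite leqn0 => /eqP->.
  rewrite leq_eqVlt => /predU1P[-> //|le_ij lt_jn].
  by have := IHj le_ij (ltnW lt_jn); have /andP[] := gap_f j lt_jn; lia.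
suff: r j <= r i /\ f i <= f j + (r i - r j) by case.
elim: i le_ji le_in => [|i IHi]; first by rewrite leqn0 => /eqP->; lia.
rewrite leq_eqVlt => /predU1P[<-|le_ji lt_in]; first by lia.
have [] := IHi le_ji (ltnW lt_in); have /andP[] := gap_f i lt_in.
by have := homo_r i lt_in; lia.
Qed.

(** * Counting closed height vectors *)

Section OrbitCount.

Variables (m : nat) (p t : nat -> nat) (r : nat -> nat -> nat).
Hypothesis prime_p : forall j : 'I_m, prime (p j).
Hypothesis inj_p : forall j j' : 'I_m, p j = p j' -> j = j'.
Hypothesis lt_r : forall (j : 'I_m) i, i < t j -> r j i < r j i.+1.

Let part (j : 'I_m) : finType := 'I_(t j).+1.
(** A label stands for one pair of a prime and an exponent; cyclic summands of equal order share it,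
    which is how multiplicities drop out. *)
Let label := {j : 'I_m & part j}.
Let label_of (j : 'I_m) l : label := Tagged part (inord l : part j).

Variables (gT : finGroupType) (G : {group gT}) (I : finType) (b : I -> gT).
Hypothesis defG : (\big[dprod/1]_i <[b i]>)%g = G.
Variables (lab : I -> label) (gen : label -> I).
Hypothesis genK : cancel gen lab.

Let P i := p (tag (lab i)).
Let R i := r (tag (lab i)) (tagged (lab i)).
Hypothesis order_b : forall i, #[b i] = P i ^ R i.

(** Parameters for closed height vectors: independent bounded choices whose partial sums, prime by
    prime, are the heights. *)
Let jumps := {dffun forall k : label, 'I_(gap (r (tag k)) (tagged k)).+1}.
Let jump (d : jumps) (j : 'I_m) (l : nat) : nat := d (label_of j l).
Let height_at (d : jumps) (j : 'I_m) (i : nat) := \sum_(l < i.+1) jump d j l.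
Let std (d : jumps) (i : I) := height_at d (tag (lab i)) (tagged (lab i)).

Lemma label_ofK (j : 'I_m) (i : part j) : label_of j i = Tagged part i.
Proof. by rewrite /label_of inord_val. Qed.

Lemma jump_le d (j : 'I_m) l : l <= t j -> jump d j l <= gap (r j) l.
Proof.
move=> le_l; rewrite /jump -ltnS; case: (d _) => x /=.
by rewrite inordK.
Qed.

Lemma height_at_le d (j : 'I_m) i i' : i <= t j -> i' <= t j ->
  height_at d j i <= height_at d j i' + (r j i - r j i').
Proof.
apply: leq_gaps => l lt_l; first exact/ltnW/lt_r.
rewrite /height_at [in X in _ <= X <= _]big_ord_recr /= leq_addr leq_add2l.
exact: jump_le.
Qed.

Lemma height_at_le_r d (j : 'I_m) i : i <= t j -> height_at d j i <= r j i.
Proof.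
move=> le_i; rewrite -(@sum_gap (r j) i) => [|l lt_l]; last first.
  by rewrite ltnW // lt_r // (leq_trans lt_l).
by apply: leq_sum => l _; rewrite jump_le // (leq_trans _ le_i) // -ltnS.
Qed.

Lemma std_closed d : closed_heights P R (std d).
Proof.
move=> i i'; rewrite /P /std /R.
case: (lab i) (lab i') => [j l] [j' l'] /= /inj_p eq_jj'.
by case: _ / eq_jj' in l' *; rewrite height_at_le // -ltnS.
Qed.

Lemma std_heights d : heights P R (fun i => P i ^ std d i) =1 std d.
Proof.
move=> i; rewrite /heights height_exp ?prime_p //.
by rewrite /std /R height_at_le_r // -ltnS.
Qed.

Lemma std_inj d d' : std d =1 std d' -> d = d'.
Proof.
move=> eq_dd'; apply/ffunP => -[j i].
have eq_h l : l <= t j -> height_at d j l = height_at d' j l.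
  by move=> le_l; have := eq_dd' (gen (label_of j l));
     rewrite /std genK /= inordK.
suff: jump d j i = jump d' j i by rewrite /jump label_ofK => /val_inj.
have le_i : i <= t j by rewrite -ltnS.
case: (nat_of_ord i) le_i => [|l] le_l.
  by have := eq_h 0 le_l; rewrite /height_at !big_ord1.
have := eq_h _ le_l; rewrite /height_at big_ord_recr [RHS]big_ord_recr /=.
by have := eq_h _ (ltnW le_l); rewrite /height_at => ->; apply: addnI.
Qed.

Lemma std_surj c : closed_heights P R (heights P R c) ->
  exists d, std d =1 heights P R c.
Proof.
set h := heights P R c => hc.
pose e (j : 'I_m) l := h (gen (label_of j l)).
have eE i : h i = e (tag (lab i)) (tagged (lab i)).
  rewrite /e label_ofK; set i' := gen _.
  (* Summands with one label have equal exponents, so closedness both ways makes their heights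
     equal. *)
  have lab_i' : lab i' = lab i by rewrite genK; case: (lab i).
  have:= hc i i'; have := hc i' i; rewrite /P /R lab_i' subnn !addn0.
  by move=> le1 le2; apply/eqP; rewrite eqn_leq le1 // le2.
have e_gap (j : 'I_m) i : i < t j -> e j i <= e j i.+1 <= e j i + (r j i.+1 - r j i).
  move=> lt_i; rewrite /e.
  set k := label_of j i; set k' := label_of j i.+1.
  have := hc (gen k) (gen k'); have := hc (gen k') (gen k).
  rewrite /P /R !genK /= !inordK //; last exact: ltnW.
  move=> -> // ; rewrite andbT.
  have/eqP-> : r j i - r j i.+1 == 0 by rewrite subn_eq0 ltnW // lt_r.
  by rewrite addn0; apply.
have e_le_gap (j : 'I_m) i : i <= t j -> gap (e j) i <= gap (r j) i.
  case: i => [|i] lt_i /=; last by have /andP[_] := e_gap j i lt_i; rewrite -leq_subLR.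
  rewrite /e /h /heights.
  apply: leq_trans (height_leq _ _ (prime_p _)) _.
  by rewrite /R genK /= inordK.
(* The jumps are the differences of the given heights; [e_le_gap] keeps [inord] from falling back on
   its default. *)
exists [ffun k : label => inord (gap (e (tag k)) (tagged k))] => i.
rewrite eE /std /height_at -[RHS]sum_gap => [|l lt_l]; last first.
  suff /e_gap/andP[] : l < t (tag (lab i)) by [].
  by rewrite (leq_trans lt_l) // -ltnS.
apply: eq_bigr => l _.
have le_l : l <= t (tag (lab i)) by rewrite -ltnS (leq_trans (ltn_ord l)).
by rewrite /jump ffunE /= !inordK // ltnS e_le_gap.
Qed.

Lemma card_jumps :
  #|{: jumps}| = \prod_(j < m) \prod_(i < (t j).+1) (gap (r j) i).+1.
Proof.
rewrite card_dep_ffun foldrE big_image sig_big_dep /=.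
by apply: eq_bigr => k _; rewrite card_ord.
Qed.

Lemma aut_orbit_count_jumps : aut_orbit_count G = #|{: jumps}|.
Proof.
have prP i : prime (P i) by apply: prime_p.
pose elt d := coord_prod b (fun i => P i ^ std d i).
have elt_closed d : closed_heights P R (heights P R (fun i => P i ^ std d i)).
  by move=> i i' eqP; rewrite !std_heights; apply: std_closed.
have le_std d d' : elt d \in orbit 'P (Aut G) (elt d') -> forall i, std d' i <= std d i.
  case/orbitP => a aG; rewrite /= apermE => aE i.
  have := heights_le_Aut defG prP order_b aG aE (elt_closed d') i.
  by rewrite !std_heights.
have inj_orb : injective (fun d => orbit 'P (Aut G) (elt d)).
  (* Both representatives are closed, so [le_std] applies in either direction. *)
  move=> d d' eq_orb; apply: std_inj => i; apply/eqP; rewrite eqn_leq.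
  by rewrite !le_std // ?eq_orb ?orbit_refl // -eq_orb orbit_refl.
rewrite -(card_imset _ inj_orb) /aut_orbit_count; apply: eq_card => X.
apply/imsetP/imsetP => [[x /(coord_prod_surj defG)[c ->] ->] | [d _ ->]]; last first.
  by exists (elt d) => //; apply: coord_prod_in.
have [c' orb_c' /std_surj[d dE]] := orbit_closed defG prP order_b c.
exists d => //; apply/orbit_eqP; rewrite orbit_sym.
apply: orbit_trans orb_c'; rewrite orbit_sym.
have := orbit_heights defG prP order_b c'; congr (_ \in orbit _ _ _).
by apply: eq_bigr => i _; rewrite dE.
Qed.

End OrbitCount.

(** * From lists of cyclic orders to labels *)

(** Only the set of orders occurring in [q] is constrained, so one statement covers both the full
    group and its repetition-free parts. *)
Lemma cyclic_decomp_orbit_count (m : nat) (p s : nat -> nat)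
    (r : nat -> nat -> nat) (q : seq nat) (gT : finGroupType) (G : {group gT}) :
    (forall j, j < m -> prime (p j)) ->
    (forall j j', j < m -> j' < m -> p j = p j' -> j = j') ->
    (forall j, j < m -> 0 < s j) ->
    (forall j, j < m -> 1 <= r j 0) ->
    (forall j i, j < m -> i.+1 < s j -> r j i < r j i.+1) ->
    (forall n, reflect (exists j i, [/\ j < m, i < s j & n = p j ^ r j i]) (n \in q)) ->
    cyclic_decomp_type G q ->
  aut_orbit_count G = \prod_(j < m) orbit_factor (s j) (r j).
Proof.
move=> pr_p inj_p s_gt0 r_gt0 lt_r qP [b [defG perm_b]].
pose t j := (s j).-1.
have sE (j : 'I_m) : s j = (t j).+1 by rewrite prednK ?s_gt0.
have lt_rt (j : 'I_m) i : i < t j -> r j i < r j i.+1.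
  by move=> lt_i; apply: lt_r; rewrite ?sE.
have r_gt (j : 'I_m) i : i <= t j -> 0 < r j i.
  elim: i => [|i IHi] le_i; first exact: r_gt0.
  exact: leq_ltn_trans (lt_rt _ _ le_i).
have r_inj (j : 'I_m) i i' : i <= t j -> i' <= t j -> r j i = r j i' -> i = i'.
  have mono_r i1 i2 : i1 < i2 -> i2 <= t j -> r j i1 < r j i2.
    elim: i2 => // i2 IHi2; rewrite ltnS leq_eqVlt => /predU1P[->|lt_i] le_t.
      exact: lt_rt.
    exact: ltn_trans (IHi2 lt_i (ltnW le_t)) (lt_rt _ _ le_t).
  move=> le_i le_i' eq_r; case: (ltngtP i i') => // lt_i.
    by have := mono_r _ _ lt_i le_i'; rewrite eq_r ltnn.
  by have := mono_r _ _ lt_i le_i; rewrite eq_r ltnn.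
pose part (j : 'I_m) : finType := 'I_(t j).+1.
pose ord_of (k : {j : 'I_m & part j}) := p (tag k) ^ r (tag k) (tagged k).
(* Exponents are positive, so an order determines its prime, and then its exponent. *)
have ord_inj : injective ord_of.
  move=> [j i] [j' i']; rewrite /ord_of /= => eq_pr.
  have pr := pr_p _ (ltn_ord j); have pr' := pr_p _ (ltn_ord j').
  have /eqP eq_p : p j == p j'.
    rewrite -dvdn_prime2 //; have: p j %| p j' ^ r j' i'.
      by rewrite -eq_pr dvdn_exp ?r_gt // -ltnS.
    by rewrite Euclid_dvdX // => /andP[].
  have eq_j : j = j' by apply/val_inj; apply: inj_p eq_p.
  case: _ / eq_j in i' eq_pr eq_p *; congr existT; apply/val_inj.
  move/eqP: eq_pr; rewrite eqn_exp2l ?prime_gt1 // => /eqP.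
  by apply: r_inj; rewrite -ltnS.
rewrite (eq_bigr (fun j : 'I_m => \prod_(i < (t j).+1) (gap (r j) i).+1)); last first.
  by move=> j _; rewrite orbit_factor_gap ?s_gt0.
have memb n : (n \in [seq #[x] | x <- b]) = (n \in q) by apply: perm_mem.
pose bt := tnth (in_tuple b).
have /fin_all_exists[lab labE] (i : 'I_(size b)) : exists k, #[bt i] = ord_of k.
  have /qP[j [l [lt_j lt_l ->]]] : #[bt i] \in q.
    by rewrite -memb map_f // mem_tnth.
  rewrite (sE (Ordinal lt_j)) in lt_l.
  by exists (Tagged part (Ordinal lt_l : part (Ordinal lt_j))).
have /fin_all_exists[gen genE] k : exists i, #[bt i] = ord_of k.
  have: ord_of k \in q.
    by case: k => j l; apply/qP; exists j, l; rewrite sE; split=> //.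
  by rewrite -memb => /mapP[x /(tnthP (in_tuple b))[i ->] ->]; exists i.
have genK : cancel gen lab by move=> k; apply: ord_inj; rewrite -labE.
rewrite -card_jumps; apply: aut_orbit_count_jumps genK labE => //.
- by move=> j; apply: pr_p.
- by move=> j j' eq_p; apply/val_inj; apply: inj_p eq_p.
- by rewrite -defG [RHS]big_tnth.
Qed.

Theorem theorem2
  (m : nat) (p s : nat -> nat) (r k : nat -> nat -> nat)
  (Hp : forall j, j < m -> prime (p j))
  (Hdist : forall j j', j < m -> j' < m -> p j = p j' -> j = j')
  (Hs : forall j, j < m -> 0 < s j)
  (Hr1 : forall j, j < m -> 1 <= r j 0)
  (Hrinc : forall j i, j < m -> i.+1 < s j -> r j i < r j i.+1)
  (Hk : forall j i, j < m -> i < s j -> 1 <= k j i)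
  (gT : finGroupType) (G : {group gT})
  (HG : cyclic_decomp_type G (full_type m p s r k)) :
  (forall j, j < m ->
     forall (hT : finGroupType) (H : {group hT}),
       cyclic_decomp_type H (rf_type (p j) (s j) (r j)) ->
       aut_orbit_count H = orbit_factor (s j) (r j))
  /\ aut_orbit_count G = \prod_(j < m) orbit_factor (s j) (r j).
Proof.
split=> [j lt_jm hT H decH | ].
  (* A single primary part is the case of one prime. *)
  suff: aut_orbit_count H = \prod_(i < 1) orbit_factor (s j) (r j) by rewrite big_ord1.
  apply: (@cyclic_decomp_orbit_count 1 (fun=> p j) (fun=> s j) (fun=> r j)) decH; auto;
    first by case=> [|i] [|i'].
  move=> n; apply: (iffP mapP) => [[i] | [_ [i [_ lt_i ->]]]].
    by rewrite mem_iota => /andP[_ lt_i] ->; exists 0, i.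
  by exists i; rewrite ?mem_iota.
apply: cyclic_decomp_orbit_count HG; auto. move=> n; apply: (iffP flatten_mapP) => [[j] | [j [i [lt_j lt_i ->]]]].
  rewrite mem_iota => /andP[_ lt_j] /flatten_mapP[i]; rewrite mem_iota => /andP[_ lt_i].
  by rewrite mem_nseq => /andP[_ /eqP->]; exists j, i.
exists j; first by rewrite mem_iota.
apply/flatten_mapP; exists i; first by rewrite mem_iota.
(* Positive multiplicity ensures that the order really occurs in the list. *)
by rewrite mem_nseq Hk /=.
Qed.
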